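(* Let $d\ge 9$. Let $\theta_1(\beta,d)$ denote the first coordinate of the drift $\theta(\beta,d)\in\mathbb{R}^d$ of excited random walk in dimension $d$ with excitement parameter $\beta\in[0,1]$. Then the map $\beta\mapsto\theta_1(\beta,d)$ is strictly increasing on $[0,1]$.
   Context: Excited random walk (ERW) in dimension $d$ with excitement parameter $\beta\in[0,1]$ is the nearest-neighbour process $(\omega_n)_{n\ge 0}$ on $\mathbb{Z}^d$ with $\omega_0=0$ such that, conditionally on $(\omega_0,\dots,\omega_n)$, the probability of $\omega_{n+1}=\omega_n+x$ (for $|x|=1$) is $p_\beta(x)=\frac{1+\beta\, e_1\cdot x}{2d}$ if $\omega_n\notin\{\omega_0,\dots,\omega_{n-1}\}$ (first visit to the current site), and $p_0(x)=\frac1{2d}$ otherwise. Here $e_1=(1,0,\dots,0)$. At time $0$ the walker is at a new site, so the first step has law $p_\beta$. The drift $\theta(\beta,d)\in\mathbb{R}^d$ is the deterministic vector such that $n^{-1}\omega_n\to\theta(\beta,d)$ almost surely as $n\to\infty$ (it is known that this limit exists for $d\ge2$; by symmetry only its first coordinate can be non-zero). *)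

(* Defs.v *)
From HB Require Import structures.
From mathcomp Require Import all_boot all_order all_algebra.
From mathcomp Require Import all_classical all_reals all_analysis.
Set Implicit Arguments.
Unset Strict Implicit.
Unset Printing Implicit Defensive.
Import Order.TTheory GRing.Theory Num.Theory.
Import numFieldNormedType.Exports.
Local Open Scope classical_set_scope.
Local Open Scope ring_scope.

(* The dimension is written d.+1, so that the lattice Z^(d.+1) is
   'rV[int]_d.+1 and its first coordinate has index ord0. *)

Definition e1 (d : nat) : 'rV[int]_d.+1 := delta_mx ord0 ord0.

Definition dot (d : nat) (x y : 'rV[int]_d.+1) : int :=
  \sum_(i < d.+1) x ord0 i * y ord0 i.

(* p_beta; the test says that the Euclidean norm of x is 1. *)
Definition step_prob (R : realType) (d : nat) (beta : R)
    (x : 'rV[int]_d.+1) : R :=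
  if dot x x == 1 then (1 + beta * (dot (e1 d) x)%:~R) / (2 * d.+1%:R) else 0.

Definition new_site (d : nat) (x : nat -> 'rV[int]_d.+1) (n : nat) : bool :=
  x n \notin [seq x k | k <- iota 0 n].

Definition history (T : Type) (d : nat) (omega : nat -> T -> 'rV[int]_d.+1)
    (x : nat -> 'rV[int]_d.+1) (n : nat) : set T :=
  [set t | forall k, (k <= n)%N -> omega k t = x k].

(* Elementary conditional probability, meaningful when 0 < P B. *)
Definition cond_prob (R : realType) (disp : measure_display)
    (T : measurableType disp) (P : probability T R) (A B : set T) : R :=
  fine (P (A `&` B)) / fine (P B).

(* The state space is countable and discrete, so measurability of omega n is
   measurability of its fibres. *)
Definition is_ERW (R : realType) (d : nat) (beta : R)
    (disp : measure_display) (T : measurableType disp) (P : probability T R)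
    (omega : nat -> T -> 'rV[int]_d.+1) : Prop :=
  [/\ forall n x, measurable (omega n @^-1` [set x]),
      forall t, omega 0%N t = 0 &
      forall (n : nat) (x : nat -> 'rV[int]_d.+1) (y : 'rV[int]_d.+1),
        (0 < P (history omega x n))%E ->
        cond_prob P [set t | omega n.+1 t = omega n t + y] (history omega x n)
        = step_prob (if new_site x n then beta else 0) y].

(* The law of the walk is determined by beta and d, so the choice of the
   realization (T, P, omega) is immaterial and theta is unique. *)
Definition is_ERW_drift (R : realType) (d : nat) (beta : R)
    (theta : 'rV[R]_d.+1) : Prop :=
  exists (disp : measure_display) (T : measurableType disp)
    (P : probability T R) (omega : nat -> T -> 'rV[int]_d.+1),
    is_ERW beta P omega /\
    {ae P, forall t, (fun n : nat => n%:R^-1 *: map_mx intr (omega n t))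
                       @ \oo --> theta}.

(* Main.v *)
(** In dimension [d], the first coordinate of the walk has mean [beta / d]
    times the expected number of sites seen for the first time, so the claim is
    that [beta] times the density of fresh sites increases. The other
    coordinates perform a lazy simple random walk in dimension [d - 1 >= 8]
    whatever [beta] and the past are. Run two walks with the same lateral path
    and first coordinates shifted against each other from some time [k] on:
    whether the current site is fresh can differ only when the lateral path is
    back at one of its positions up to time [k], and such a discrepancy creates
    a new shift with probability at most [beta / (2 d)] per occurrence. In
    dimension at least 8 a lateral path is so transient that the expected
    number of discrepancies, weighted by [beta / d], stays below the immediate
    gain of a step [e_1] over a step [- e_1]. Replacing [beta1] by [beta2] one
    step at a time (Duhamel's formula) therefore increases the mean
    displacement by at least [(beta2 - beta1) n / (9 d)] in [n] steps. All
    Green function estimates come from two explicit superharmonic functions of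
    the lateral distance. *)

Require Import Defs.
From HB Require Import structures.
From mathcomp Require Import all_boot all_order all_algebra.
From mathcomp Require Import all_classical all_reals all_analysis.
From mathcomp Require Import measurable_realfun.
From mathcomp Require Import zify ring lra.
Set Implicit Arguments.
Unset Strict Implicit.
Unset Printing Implicit Defensive.
Import Order.TTheory GRing.Theory Num.Theory.
Import numFieldNormedType.Exports.
Local Open Scope classical_set_scope.
Local Open Scope ring_scope.

(** * Superharmonic functions of the lateral distance *)

(* [green] and [green2], taken at the squared lateral norm [q], dominate the
   Green function of the lateral walk and its convolution square; the numbers 2
   and 5 make [avg_green_hit], [avg_green_sqr] and [avg_green2] true together in
   every lateral dimension at least 8. *)
Definition green (R : realFieldType) (q : int) : R :=
  (q == 0)%:R + 2 / (2 + q%:~R) ^+ 2.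

Definition green2 (R : realFieldType) (q : int) : R :=
  (q == 0)%:R + 5 / (2 + q%:~R).

(* The values of [lsq] at the two neighbours of a point in a lateral direction
   are [q + 1 + 2 v] and [q + 1 - 2 v], where [v] is the coordinate there. *)
Lemma indicator_neighbours (R : realFieldType) (q v : int) : v ^+ 2 <= q ->
  (q + 1 + 2 * v == 0)%:R + (q + 1 - 2 * v == 0)%:R
    <= v%:~R ^+ 2 * (q == 1)%:R :> R.
Proof.
move=> hv; case: (eqVneq (q + 1 + 2 * v) 0) => h1.
  (* A zero value means [q = -1 - 2 v], and then [v^2 <= q] completes a square. *)
  have e : (v + 1) ^+ 2 <= 0 by lia.
  have {e} ev : v = -1.
    by apply/eqP; rewrite -subr_eq0 opprK -sqrf_eq0 eq_le e sqr_ge0.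
  rewrite ev in h1 *; have -> : q = 1 by lia.
  by rewrite rmorphN sqrrN rmorph1 expr1n mul1r addr0.
case: (eqVneq (q + 1 - 2 * v) 0) => h2.
  have e : (v - 1) ^+ 2 <= 0 by lia.
  have {e} ev : v = 1.
    by apply/eqP; rewrite -subr_eq0 -sqrf_eq0 eq_le e sqr_ge0.
  rewrite ev in h2 *; have -> : q = 1 by lia.
  by rewrite rmorph1 expr1n mul1r add0r.
by rewrite addr0 mulr_ge0 ?sqr_ge0.
Qed.

(** The excess over [2 / s] is exactly [8 v^2 / (s (s^2 - 4 v^2))]. Replacing [s^2 - 4 v^2] by [w],
    later chosen free of [v], leaves a bound affine in [v^2], which can be summed over the axes. *)
Lemma inv_neighbours (R : realFieldType) (s v w : R) :
  0 < w -> w <= s ^+ 2 - 4 * v ^+ 2 -> 0 < s - 2 * v -> 0 < s + 2 * v ->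
  1 / (s + 2 * v) + 1 / (s - 2 * v) <= 2 / s + v ^+ 2 * (8 / (s * w)).
Proof.
move=> w0 hw s1 s2.
have s0 : 0 < s by lra.
have p0 : 0 < s ^+ 2 - 4 * v ^+ 2 by apply: lt_le_trans hw.
rewrite -subr_ge0.
have -> : 2 / s + v ^+ 2 * (8 / (s * w)) - (1 / (s + 2 * v) + 1 / (s - 2 * v))
  = 8 * v ^+ 2 * ((s ^+ 2 - 4 * v ^+ 2) - w)
    / (s * w * ((s + 2 * v) * (s - 2 * v))).
  by field; rewrite !gt_eqF.
apply: divr_ge0; last by rewrite !mulr_ge0 // ltW.
by rewrite (mulr_ge0 (mulr_ge0 _ (sqr_ge0 v))) ?subr_ge0.
Qed.

(** An exact expansion in [v], with a quartic remainder of negative sign that is dropped. *)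
Lemma invsqr_neighbours (R : realFieldType) (s v w : R) :
  0 < w -> w <= s ^+ 2 - 4 * v ^+ 2 -> 0 < s - 2 * v -> 0 < s + 2 * v ->
  1 / (s + 2 * v) ^+ 2 + 1 / (s - 2 * v) ^+ 2
    <= 2 / s ^+ 2 + v ^+ 2 * (24 / w ^+ 2).
Proof.
move=> w0 hw s1 s2.
have s0 : 0 < s by lra.
set p := s ^+ 2 - 4 * v ^+ 2 in hw.
have p0 : 0 < p by apply: lt_le_trans hw.
have -> : 1 / (s + 2 * v) ^+ 2 + 1 / (s - 2 * v) ^+ 2
  = 2 / s ^+ 2 + v ^+ 2 * (24 / p ^+ 2) - 32 * v ^+ 4 / (s * p) ^+ 2.
  have pE : p = (s + 2 * v) * (s - 2 * v) by rewrite /p; ring.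
  by rewrite pE; field; rewrite !gt_eqF.
have h1 : 24 / p ^+ 2 <= 24 / w ^+ 2.
  rewrite ler_pM2l // lef_pV2 ?posrE ?exprn_gt0 //.
  by rewrite lerXn2r // nnegrE ltW.
have h2 : 0 <= 32 * v ^+ 4 / (s * p) ^+ 2.
  by rewrite divr_ge0 ?sqr_ge0 // mulr_ge0 // exprn_even_ge0.
have := ler_wpM2l (sqr_ge0 v) h1; lra.
Qed.

(** Here [s = 2 + (q + 1)] is the denominator at the mean squared norm of the two neighbours, and
    [w] is the value of [s^2 - 4 v^2] in the extreme case [v^2 = q]. *)
Lemma neighbour_bounds (R : realFieldType) (q v : int) : v ^+ 2 <= q ->
  let s : R := 3 + q%:~R in let w : R := (q%:~R + 1) ^+ 2 + 8 in
  [/\ 0 < w, w <= s ^+ 2 - 4 * v%:~R ^+ 2, 0 < s - 2 * v%:~R &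
      0 < s + 2 * v%:~R].
Proof.
move=> hv s w; rewrite /s /w.
have hv' : (v%:~R : R) ^+ 2 <= q%:~R by rewrite -rmorphXn /= ler_int.
split; [have := sqr_ge0 (q%:~R + 1 : R); lra | lra | |].
- have := sqr_ge0 (v%:~R - 1 : R); lra.
- have := sqr_ge0 (v%:~R + 1 : R); lra.
Qed.

(** The coefficient of [v^2] in [green_neighbours]: the indicator comes from a neighbour at lateral
    distance 0, and [48] is [2 * 24]. In [green2_slope] the constant [40] is [5 * 8]. *)
Definition green_slope (R : realFieldType) (q : int) : R :=
  (q == 1)%:R + 48 / ((q%:~R + 1) ^+ 2 + 8) ^+ 2.

Definition green2_slope (R : realFieldType) (q : int) : R :=
  (q == 1)%:R + 40 / ((3 + q%:~R) * ((q%:~R + 1) ^+ 2 + 8)).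

Lemma green_neighbours (R : realFieldType) (q v : int) : v ^+ 2 <= q ->
  green R (q + 1 + 2 * v) + green R (q + 1 - 2 * v)
    <= 4 / (3 + q%:~R) ^+ 2 + v%:~R ^+ 2 * green_slope R q.
Proof.
move=> hv; rewrite /green /green_slope.
have := indicator_neighbours R hv.
have [w0 hw s1 s2] := neighbour_bounds R hv.
have := invsqr_neighbours w0 hw s1 s2.
rewrite !(rmorphD, rmorphB, rmorphN, rmorphM, rmorph1) /=.
have -> : 2 + (q%:~R + 1 + 2%:~R * v%:~R) = 3 + q%:~R + 2 * v%:~R :> R by ring.
have -> : 2 + (q%:~R + 1 - 2%:~R * v%:~R) = 3 + q%:~R - 2 * v%:~R :> R by ring.
by lra.
Qed.

Lemma green2_neighbours (R : realFieldType) (q v : int) : v ^+ 2 <= q ->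
  green2 R (q + 1 + 2 * v) + green2 R (q + 1 - 2 * v)
    <= 10 / (3 + q%:~R) + v%:~R ^+ 2 * green2_slope R q.
Proof.
move=> hv; rewrite /green2 /green2_slope.
have := indicator_neighbours R hv.
have [w0 hw s1 s2] := neighbour_bounds R hv.
have := inv_neighbours w0 hw s1 s2.
rewrite !(rmorphD, rmorphB, rmorphN, rmorphM, rmorph1) /=.
have -> : 2 + (q%:~R + 1 + 2%:~R * v%:~R) = 3 + q%:~R + 2 * v%:~R :> R by ring.
have -> : 2 + (q%:~R + 1 - 2%:~R * v%:~R) = 3 + q%:~R - 2 * v%:~R :> R by ring.
by lra.
Qed.

Lemma int_cases012 (q : int) : 0 <= q -> [\/ q = 0, q = 1 | 2 <= q].
Proof.
case: q => // -[|[|n]] _; [by constructor 1 | by constructor 2 |].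
by constructor 3.
Qed.

(** The case [q >= 2] of [avg_green_sqr], with [m] the lateral dimension and [a = 2 + q]. In the
    variables [m = 8 + k] and [a = 4 + t] the difference of the sides has a numerator affine in [k]
    whose coefficients are, up to powers of [w], polynomials in [t] with positive coefficients. *)
Lemma green_drift_far (R : realFieldType) (m a : R) : 8 <= m -> 4 <= a ->
  2 * (2 / a ^+ 2) + m * (4 / (a + 1) ^+ 2)
    + (a - 2) * (48 / (a ^+ 2 - 2 * a + 9) ^+ 2)
    <= 2 * (m + 1) * (2 / a ^+ 2 - (2 / a ^+ 2) ^+ 2 / 9).
Proof.
move=> hm ha.
have [t t0 ->] : exists2 t, 0 <= t & a = 4 + t.
  by exists (a - 4); lra.
have [k k0 ->] : exists2 k, 0 <= k & m = 8 + k.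
  by exists (m - 8); lra.
set w := (4 + t) ^+ 2 - 2 * (4 + t) + 9.
have w0 : 0 < w by rewrite /w; have := sqr_ge0 t; lra.
have t4 : 0 < 4 + t by lra.
have t5 : 0 < 4 + t + 1 by lra.
rewrite -subr_ge0.
have -> : 2 * (8 + k + 1) * (2 / (4 + t) ^+ 2 - (2 / (4 + t) ^+ 2) ^+ 2 / 9)
   - (2 * (2 / (4 + t) ^+ 2) + (8 + k) * (4 / (4 + t + 1) ^+ 2)
      + (4 + t - 2) * (48 / w ^+ 2))
 = (((32 * (2 * (4 + t) + 1) * (4 + t) ^+ 2 - 8 * (4 + t + 1) ^+ 2) * w ^+ 2
     - 48 * (4 + t - 2) * (4 + t) ^+ 4 * (4 + t + 1) ^+ 2)
    + k * (4 * (2 * (4 + t) + 1) * (4 + t) ^+ 2 - 8 / 9 * (4 + t + 1) ^+ 2)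
      * w ^+ 2)
   / ((4 + t) ^+ 4 * (4 + t + 1) ^+ 2 * w ^+ 2).
  by field; rewrite !gt_eqF.
have -> : (32 * (2 * (4 + t) + 1) * (4 + t) ^+ 2 - 8 * (4 + t + 1) ^+ 2)
     * w ^+ 2 - 48 * (4 + t - 2) * (4 + t) ^+ 4 * (4 + t + 1) ^+ 2
   = 8 * ((82 * 10 ^+ 3 + 439) + (83 * 10 ^+ 3 + 818) * t
     + (33 * 10 ^+ 3 + 653) * t ^+ 2 + (6 * 10 ^+ 3 + 852) * t ^+ 3
     + 917 * t ^+ 4 + 156 * t ^+ 5 + 27 * t ^+ 6 + 2 * t ^+ 7).
  by rewrite /w; ring.
have -> : 4 * (2 * (4 + t) + 1) * (4 + t) ^+ 2 - 8 / 9 * (4 + t + 1) ^+ 2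
   = 4984 / 9 + 3664 / 9 * t + 892 / 9 * t ^+ 2 + 8 * t ^+ 3.
  by field.
apply: divr_ge0; last by rewrite !mulr_ge0 ?exprn_ge0 // ltW.
have tk j : 0 <= t ^+ j by exact: exprn_ge0.
apply: addr_ge0.
  have := (tk 2, tk 3, tk 4); have := (tk 5, tk 6, tk 7).
  by move=> [[? ?] ?] [[? ?] ?]; lra.
have [t2 t3] := (tk 2, tk 3).
apply: mulr_ge0 (sqr_ge0 w); apply: mulr_ge0 k0 _; lra.
Qed.

Lemma green2_drift_far (R : realFieldType) (m a : R) : 8 <= m -> 4 <= a ->
  2 * (5 / a) + m * (10 / (a + 1))
    + (a - 2) * (40 / ((a + 1) * (a ^+ 2 - 2 * a + 9)))
    <= 2 * (m + 1) * (5 / a - 2 / a ^+ 2).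
Proof.
move=> hm ha.
have [t t0 ->] : exists2 t, 0 <= t & a = 4 + t.
  by exists (a - 4); lra.
have [k k0 ->] : exists2 k, 0 <= k & m = 8 + k.
  by exists (m - 8); lra.
set w := (4 + t) ^+ 2 - 2 * (4 + t) + 9.
have w0 : 0 < w by rewrite /w; have := sqr_ge0 t; lra.
have t4 : 0 < 4 + t by lra.
have t5 : 0 < 4 + t + 1 by lra.
rewrite -subr_ge0.
have -> : 2 * (8 + k + 1) * (5 / (4 + t) - 2 / (4 + t) ^+ 2)
   - (2 * (5 / (4 + t)) + (8 + k) * (10 / (4 + t + 1))
      + (4 + t - 2) * (40 / ((4 + t + 1) * w)))
 = ((80 * (4 + t) * w - 36 * (4 + t + 1) * w
     - 40 * (4 + t - 2) * (4 + t) ^+ 2) + k * (20 + 6 * t) * w)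
   / ((4 + t) ^+ 2 * (4 + t + 1) * w).
  by field; rewrite !gt_eqF.
have -> : 80 * (4 + t) * w - 36 * (4 + t + 1) * w
     - 40 * (4 + t - 2) * (4 + t) ^+ 2
   = 1100 + 308 * t + 4 * t ^+ 2 + 4 * t ^+ 3.
  by rewrite /w; ring.
apply: divr_ge0; last by rewrite !mulr_ge0 ?exprn_ge0 // ltW.
have tk j : 0 <= t ^+ j by exact: exprn_ge0.
have [t2 t3] := (tk 2, tk 3).
apply: addr_ge0; first by lra.
apply: mulr_ge0 (ltW w0); apply: mulr_ge0 k0 _; lra.
Qed.

(* The squared norm of the coordinates other than the first. *)
Definition lsq (d : nat) (x : 'rV[int]_d.+1) : int :=
  \sum_(i < d) x ord0 (lift ord0 i) ^+ 2.

Definition unitv (d : nat) (i : 'I_d.+1) : 'rV[int]_d.+1 := delta_mx ord0 i.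

Definition avg (R : realFieldType) (d : nat) (f : 'rV[int]_d.+1 -> R)
    (x : 'rV[int]_d.+1) : R :=
  (\sum_(i < d.+1) (f (x + unitv i) + f (x - unitv i))) / (2 * d.+1%:R).

Lemma lsq_ge0 (d : nat) (x : 'rV[int]_d.+1) : 0 <= lsq x.
Proof. by apply: sumr_ge0 => i _; rewrite sqr_ge0. Qed.

Lemma lsqN (d : nat) (x : 'rV[int]_d.+1) : lsq (- x) = lsq x.
Proof. by apply: eq_bigr => i _; rewrite mxE sqrrN. Qed.

Lemma coord_sq_le (d : nat) (x : 'rV[int]_d.+1) (i : 'I_d) :
  x ord0 (lift ord0 i) ^+ 2 <= lsq x.
Proof.
by rewrite /lsq (bigD1 i) //= lerDl sumr_ge0 // => j _; rewrite sqr_ge0.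
Qed.

Lemma lsqD_unitv0 (d : nat) (x : 'rV[int]_d.+1) (e : int) :
  lsq (x + e *: unitv ord0) = lsq x.
Proof.
apply: eq_bigr => i _; by rewrite !mxE /= mulr0 addr0.
Qed.

Lemma lsqD_unitv (d : nat) (x : 'rV[int]_d.+1) (e : int) (i : 'I_d) :
  lsq (x + e *: unitv (lift ord0 i))
    = lsq x + e ^+ 2 + 2 * e * x ord0 (lift ord0 i).
Proof.
rewrite /lsq (bigD1 i) //= [in RHS](bigD1 i) //= !mxE !eqxx /= mulr1.
rewrite (eq_bigr (fun j => x ord0 (lift ord0 j) ^+ 2)); last first.
  move=> j ji; rewrite !mxE /= (inj_eq lift_inj) (negPf ji).
  by rewrite mulr0 addr0.
ring.
Qed.

Lemma avg_lsq (R : realFieldType) (d : nat) (phi : int -> R)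
    (x : 'rV[int]_d.+1) :
  avg (fun z => phi (lsq z)) x =
    (2 * phi (lsq x) + \sum_(i < d)
       (phi (lsq x + 1 + 2 * x ord0 (lift ord0 i))
        + phi (lsq x + 1 - 2 * x ord0 (lift ord0 i)))) / (2 * d.+1%:R).
Proof.
rewrite /avg big_ord_recl; congr ((_ + _) / _).
  have := lsqD_unitv0 x 1; have := lsqD_unitv0 x (-1).
  by rewrite scale1r scaleN1r => -> ->; ring.
apply: eq_bigr => i _.
have := lsqD_unitv x 1 i; have := lsqD_unitv x (-1) i.
rewrite scale1r scaleN1r => -> ->.
by congr (phi _ + phi _); ring.
Qed.

(** The two steps along the first axis keep [lsq]; along the lateral axes the squares [v^2] add up
    to [lsq x]. *)
Lemma avg_lsq_le (R : realFieldType) (d : nat) (phi : int -> R) (c g : R)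
    (x : 'rV[int]_d.+1) :
  (forall v : int, v ^+ 2 <= lsq x ->
     phi (lsq x + 1 + 2 * v) + phi (lsq x + 1 - 2 * v) <= c + v%:~R ^+ 2 * g) ->
  2 * d.+1%:R * avg (fun z => phi (lsq z)) x
    <= 2 * phi (lsq x) + d%:R * c + (lsq x)%:~R * g.
Proof.
move=> h; rewrite avg_lsq mulrCA divff ?mulf_neq0 ?pnatr_eq0 // mulr1.
rewrite -[leRHS]addrA lerD2l.
apply: (le_trans (ler_sum _ (fun i _ => h _ (coord_sq_le x i)))).
rewrite big_split /= sumr_const card_ord -mulr_suml -[c *+ d]mulr_natl.
rewrite /lsq rmorph_sum /= lerD2l le_eqVlt; apply/orP; left; apply/eqP.
by congr (_ * _); apply: eq_bigr => i _; rewrite rmorphXn.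
Qed.

(** * Superharmonicity of [green] and [green2] *)

Lemma green_0 (R : realFieldType) : green R 0 = 3 / 2.
Proof. by rewrite /green eqxx /=; field. Qed.

Lemma green_1 (R : realFieldType) : green R 1 = 2 / 9.
Proof. by rewrite /green /= rmorph1; field. Qed.

Lemma green2_0 (R : realFieldType) : green2 R 0 = 7 / 2.
Proof. by rewrite /green2 eqxx /=; field. Qed.

Lemma green2_1 (R : realFieldType) : green2 R 1 = 5 / 3.
Proof. by rewrite /green2 /= rmorph1; field. Qed.

Lemma green_slope_1 (R : realFieldType) : green_slope R 1 = 4 / 3.
Proof. by rewrite /green_slope eqxx rmorph1 /=; field. Qed.

Lemma green2_slope_1 (R : realFieldType) : green2_slope R 1 = 11 / 6.
Proof. by rewrite /green2_slope eqxx rmorph1 /=; field. Qed.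

(** The quadratic loss lets [gap] carry a growing sum over the past: in [gap_cons_summand] it pays
    for the term that the present site adds to this sum. *)
Lemma avg_green_sqr (R : realFieldType) (d : nat) (x : 'rV[int]_d.+1) :
  (8 <= d)%N ->
  avg (fun z => green R (lsq z)) x
    <= green R (lsq x) - green R (lsq x) ^+ 2 / 9.
Proof.
move=> hd.
have hm : 8 <= d%:R :> R by rewrite ler_nat.
have d0 : 0 < 2 * d.+1%:R :> R by rewrite mulr_gt0.
rewrite -(ler_pM2l d0).
apply: le_trans (avg_lsq_le (fun v => @green_neighbours R _ v)) _.
(* The indicators in [green] and [green_slope] act only at squared norms 0 and 1, which are settled
   numerically. *)
have [->|->|q2] := int_cases012 (lsq_ge0 x).
- rewrite green_0 rmorph0 mul0r -[d.+1%:R]natr1.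
  have -> : 4 / (3 + 0) ^+ 2 = 4 / 9 :> R by field.
  lra.
- rewrite green_1 green_slope_1 rmorph1 mul1r -[d.+1%:R]natr1.
  have -> : 4 / (3 + 1) ^+ 2 = 1 / 4 :> R by field.
  lra.
have q2R : 2 <= (lsq x)%:~R :> R by rewrite (ler_int _ 2).
have h4 : 4 <= 2 + (lsq x)%:~R :> R by lra.
have := green_drift_far hm h4.
rewrite /green /green_slope.
have -> : (lsq x == 0) = false by apply/negP; lia.
have -> : (lsq x == 1) = false by apply/negP; lia.
rewrite -[d.+1%:R]natr1.
have -> : 2 + (lsq x)%:~R + 1 = 3 + (lsq x)%:~R :> R by ring.
have -> : (2 + (lsq x)%:~R) ^+ 2 - 2 * (2 + (lsq x)%:~R) + 9
   = ((lsq x)%:~R + 1) ^+ 2 + 8 :> R by ring.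
have -> : 2 + (lsq x)%:~R - 2 = (lsq x)%:~R :> R by ring.
by rewrite !add0r.
Qed.

(** Off lateral distance 0 this is weaker than [avg_green_sqr]; at distance 0 the drop of [green]
    from [3 / 2] is large enough to pay for a visit. *)
Lemma avg_green_hit (R : realFieldType) (d : nat) (x : 'rV[int]_d.+1) :
  (8 <= d)%N ->
  (lsq x == 0)%:R + avg (fun z => green R (lsq z)) x <= green R (lsq x).
Proof.
move=> hd.
case: (eqVneq (lsq x) 0) => [q0|_]; last first.
  rewrite add0r; apply: le_trans (avg_green_sqr R x hd) _.
  by rewrite gerBl divr_ge0 ?sqr_ge0.
have hm : 8 <= d%:R :> R by rewrite ler_nat.
have d0 : 0 < 2 * d.+1%:R :> R by rewrite mulr_gt0.
rewrite -(ler_pM2l d0) mulrDr.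
have := avg_lsq_le (x := x) (fun v => @green_neighbours R _ v).
rewrite q0 green_0 rmorph0 mul0r /= mulr1 -[d.+1%:R]natr1.
have -> : 4 / (3 + 0) ^+ 2 = 4 / 9 :> R by field.
lra.
Qed.

Lemma avg_green2 (R : realFieldType) (d : nat) (x : 'rV[int]_d.+1) :
  (8 <= d)%N ->
  green R (lsq x) + avg (fun z => green2 R (lsq z)) x <= green2 R (lsq x).
Proof.
move=> hd.
have hm : 8 <= d%:R :> R by rewrite ler_nat.
have d0 : 0 < 2 * d.+1%:R :> R by rewrite mulr_gt0.
rewrite addrC -lerBrDr -(ler_pM2l d0).
apply: le_trans (avg_lsq_le (fun v => @green2_neighbours R _ v)) _.
have [->|->|q2] := int_cases012 (lsq_ge0 x).
- rewrite green_0 green2_0 rmorph0 mul0r -[d.+1%:R]natr1.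
  have -> : 10 / (3 + 0) = 10 / 3 :> R by field.
  lra.
- rewrite green_1 green2_1 green2_slope_1 rmorph1 mul1r -[d.+1%:R]natr1.
  have -> : 10 / (3 + 1) = 5 / 2 :> R by field.
  lra.
have q2R : 2 <= (lsq x)%:~R :> R by rewrite (ler_int _ 2).
have h4 : 4 <= 2 + (lsq x)%:~R :> R by lra.
have := green2_drift_far hm h4.
rewrite /green /green2 /green2_slope.
have -> : (lsq x == 0) = false by apply/negP; lia.
have -> : (lsq x == 1) = false by apply/negP; lia.
rewrite -[d.+1%:R]natr1.
have -> : 2 + (lsq x)%:~R + 1 = 3 + (lsq x)%:~R :> R by ring.
have -> : (2 + (lsq x)%:~R) ^+ 2 - 2 * (2 + (lsq x)%:~R) + 9
   = ((lsq x)%:~R + 1) ^+ 2 + 8 :> R by ring.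
have -> : 2 + (lsq x)%:~R - 2 = (lsq x)%:~R :> R by ring.
by rewrite !add0r.
Qed.

Lemma green_ge0 (R : realFieldType) (d : nat) (x : 'rV[int]_d.+1) :
  0 <= green R (lsq x).
Proof.
have h : 0 <= (lsq x)%:~R :> R by rewrite ler0z lsq_ge0.
by rewrite /green addr_ge0 // divr_ge0 ?sqr_ge0.
Qed.

Lemma green2_ge0 (R : realFieldType) (d : nat) (x : 'rV[int]_d.+1) :
  0 <= green2 R (lsq x).
Proof.
have h : 0 <= (lsq x)%:~R :> R by rewrite ler0z lsq_ge0.
by rewrite /green2 addr_ge0 // divr_ge0 // addr_ge0.
Qed.

Lemma lsq0 (d : nat) : lsq (0 : 'rV[int]_d.+1) = 0.
Proof. by rewrite /lsq big1 // => i _; rewrite mxE expr0n. Qed.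

Lemma lsqD_eq0 (d : nat) (x c : 'rV[int]_d.+1) :
  lsq c = 0 -> lsq (x + c) = lsq x.
Proof.
move=> c0; apply: eq_bigr => i _; rewrite mxE.
suff -> : c ord0 (lift ord0 i) = 0 by rewrite addr0.
apply/eqP; rewrite -sqrf_eq0 eq_le sqr_ge0 andbT.
by have := coord_sq_le c i; rewrite c0.
Qed.

Lemma lsq_unitv0 (d : nat) : lsq (unitv ord0 : 'rV[int]_d.+1) = 0.
Proof. by have := lsqD_unitv0 (0 : 'rV_d.+1) 1; rewrite scale1r add0r lsq0. Qed.

(** * One-step operators and couplings of a single step *)

Lemma avgD (R : realFieldType) (d : nat) (f g : 'rV[int]_d.+1 -> R)
    (x : 'rV[int]_d.+1) :
  avg (fun z => f z + g z) x = avg f x + avg g x.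
Proof.
rewrite /avg -mulrDl -big_split /=; congr (_ / _).
by apply: eq_bigr => i _; ring.
Qed.

Lemma avgZ (R : realFieldType) (d : nat) (a : R) (f : 'rV[int]_d.+1 -> R)
    (x : 'rV[int]_d.+1) :
  avg (fun z => a * f z) x = a * avg f x.
Proof.
rewrite /avg mulrA mulr_sumr; congr (_ / _).
by apply: eq_bigr => i _; ring.
Qed.

Lemma avg_const (R : realFieldType) (d : nat) (a : R) (x : 'rV[int]_d.+1) :
  avg (fun=> a) x = a.
Proof.
have d0 : d.+1%:R != 0 :> R by rewrite pnatr_eq0.
rewrite /avg sumr_const card_ord -[(a + a) *+ _]mulr_natl.
by field; rewrite nat1r.
Qed.

Lemma avg_sum (R : realFieldType) (d : nat) (T : Type) (s : seq T)
    (f : T -> 'rV[int]_d.+1 -> R) (x : 'rV[int]_d.+1) :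
  avg (fun z => \sum_(b <- s) f b z) x = \sum_(b <- s) avg (f b) x.
Proof.
elim: s => [|b s IH].
  rewrite big_nil -[RHS](avg_const 0 x); congr (_ / _).
  by apply: eq_bigr => i _; rewrite !big_nil.
rewrite big_cons -IH -avgD; congr (_ / _).
by apply: eq_bigr => i _; rewrite !big_cons.
Qed.

Lemma avg_shift (R : realFieldType) (d : nat) (f : 'rV[int]_d.+1 -> R)
    (c x : 'rV[int]_d.+1) :
  avg (fun z => f (z + c)) x = avg f (x + c).
Proof.
by congr (_ / _); apply: eq_bigr => i _; congr (f _ + f _); exact: addrAC.
Qed.

Lemma eq_avg (R : realFieldType) (d : nat) (f g : 'rV[int]_d.+1 -> R)
    (x : 'rV[int]_d.+1) : f =1 g -> avg f x = avg g x.
Proof. by move=> fg; congr (_ / _); apply: eq_bigr => i _; rewrite !fg. Qed.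

(* Transition operator of a walk with excitement [gamma]; only the first
   coordinate feels [gamma]. *)
Definition step (R : realFieldType) (d : nat) (gamma : R)
    (f : 'rV[int]_d.+1 -> R) (x : 'rV[int]_d.+1) : R :=
  avg f x + gamma / (2 * d.+1%:R) * (f (x + unitv ord0) - f (x - unitv ord0)).

Lemma avg_split (R : realFieldType) (d : nat) (f : 'rV[int]_d.+1 -> R)
    (x : 'rV[int]_d.+1) :
  2 * d.+1%:R * avg f x = f (x + unitv ord0) + f (x - unitv ord0)
    + \sum_(i < d) (f (x + unitv (lift ord0 i)) + f (x - unitv (lift ord0 i))).
Proof.
by rewrite /avg mulrCA divff ?mulf_neq0 ?pnatr_eq0 // mulr1 big_ord_recl.
Qed.

Lemma step_split (R : realFieldType) (d : nat) (gamma : R)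
    (f : 'rV[int]_d.+1 -> R) (x : 'rV[int]_d.+1) :
  2 * d.+1%:R * step gamma f x
    = (1 + gamma) * f (x + unitv ord0) + (1 - gamma) * f (x - unitv ord0)
    + \sum_(i < d) (f (x + unitv (lift ord0 i)) + f (x - unitv (lift ord0 i))).
Proof.
rewrite /step mulrDr avg_split.
have -> : 2 * d.+1%:R * (gamma / (2 * d.+1%:R)
    * (f (x + unitv ord0) - f (x - unitv ord0)))
  = gamma * (f (x + unitv ord0) - f (x - unitv ord0)).
  by field; rewrite nat1r pnatr_eq0.
ring.
Qed.

(** The excitement does not see [f], which agrees at both ends of the first axis, and the weights
    [1 + gamma] and [1 - gamma] are nonnegative. *)
Lemma step_ge (R : realFieldType) (d : nat) (gamma : R)
    (f g : 'rV[int]_d.+1 -> R) (x : 'rV[int]_d.+1) :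
  0 <= gamma <= 1 -> (forall z, f z <= g z) ->
  f (x + unitv ord0) = f (x - unitv ord0) -> avg f x <= step gamma g x.
Proof.
move=> /andP[g0 g1] fg fE.
have d0 : 0 < 2 * d.+1%:R :> R by rewrite mulr_gt0.
rewrite -(ler_pM2l d0) avg_split step_split.
have h1 : 0 <= (1 + gamma) * (g (x + unitv ord0) - f (x + unitv ord0)).
  by rewrite mulr_ge0 ?subr_ge0 // addr_ge0.
have h2 : 0 <= (1 - gamma) * (g (x - unitv ord0) - f (x - unitv ord0)).
  by rewrite mulr_ge0 ?subr_ge0.
apply: lerD; first by rewrite fE in h1 *; lra.
by apply: ler_sum => i _; rewrite lerD.
Qed.

Lemma ler_norml_pM (R : realFieldType) (a x y : R) :
  0 <= a -> `|x| <= y -> - (a * y) <= a * x <= a * y.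
Proof. by move=> a0 xy; rewrite -ler_norml normrM ger0_norm // ler_wpM2l. Qed.

Lemma norm_sum_neighbours (R : realFieldType) (d : nat)
    (f g K : 'rV[int]_d.+1 -> R) :
  (forall z, `|f z - g z| <= K z) -> forall x : 'rV[int]_d.+1,
  `|\sum_(i < d) (f (x + unitv (lift ord0 i)) + f (x - unitv (lift ord0 i)))
    - \sum_(i < d) (g (x + unitv (lift ord0 i)) + g (x - unitv (lift ord0 i)))|
  <= \sum_(i < d) (K (x + unitv (lift ord0 i)) + K (x - unitv (lift ord0 i))).
Proof.
move=> fgK x; rewrite -sumrB; apply: le_trans (ler_norm_sum _ _ _) _.
apply: ler_sum => i _; rewrite opprD addrACA.
by apply: le_trans (ler_normD _ _) _; rewrite lerD.
Qed.

(* Of the mass [2 / (2 d)] of the steps along the first axis, the optimal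
   coupling of excitements [gamma] and [0] lets [gamma / (2 d)] go in opposite
   directions. *)
Lemma step_coupling (R : realFieldType) (d : nat) (gamma B : R)
    (f g K : 'rV[int]_d.+1 -> R) (x : 'rV[int]_d.+1) :
  0 <= gamma <= 1 -> (forall z, `|f z - g z| <= K z) ->
  K (x + unitv ord0) = K (x - unitv ord0) ->
  `|f (x + unitv ord0) - g (x - unitv ord0)| <= B ->
  `|step gamma f x - step 0 g x|
    <= avg K x + gamma / (2 * d.+1%:R) * (B - K (x + unitv ord0)).
Proof.
move=> /andP[g0 g1] fgK KE fgB.
have d0 : 0 < 2 * d.+1%:R :> R by rewrite mulr_gt0.
rewrite -(ler_pM2l d0) -[X in X * `|_|]gtr0_norm // -normrM.
have -> : 2 * d.+1%:R * (avg K x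
    + gamma / (2 * d.+1%:R) * (B - K (x + unitv ord0)))
  = 2 * d.+1%:R * avg K x + gamma * (B - K (x + unitv ord0)).
  by field; rewrite nat1r pnatr_eq0.
rewrite mulrBr !step_split avg_split -KE.
have /andP[? ?] := ler_norml_pM g0 fgB.
have := fgK (x + unitv ord0); rewrite ler_norml => /andP[? ?].
have hm : 0 <= 1 - gamma by rewrite subr_ge0.
have := ler_norml_pM hm (fgK (x - unitv ord0)); rewrite -KE => /andP[? ?].
have := norm_sum_neighbours fgK x; rewrite !ler_norml => /andP[? ?].
by apply/andP; split; lra.
Qed.

(** With equal excitements both walks take the same step, and the excitement does not see [K]. *)
Lemma step_contract (R : realFieldType) (d : nat) (gamma : R)
    (f g K : 'rV[int]_d.+1 -> R) (x : 'rV[int]_d.+1) :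
  0 <= gamma <= 1 -> (forall z, `|f z - g z| <= K z) ->
  K (x + unitv ord0) = K (x - unitv ord0) ->
  `|step gamma f x - step gamma g x| <= avg K x.
Proof.
move=> /andP[g0 g1] fgK KE.
have d0 : 0 < 2 * d.+1%:R :> R by rewrite mulr_gt0.
rewrite -(ler_pM2l d0) -[X in X * `|_|]gtr0_norm // -normrM mulrBr.
rewrite !step_split avg_split -KE.
have hp : 0 <= 1 + gamma by rewrite addr_ge0.
have /andP[? ?] := ler_norml_pM hp (fgK (x + unitv ord0)).
have hm : 0 <= 1 - gamma by rewrite subr_ge0.
have := ler_norml_pM hm (fgK (x - unitv ord0)); rewrite -KE => /andP[? ?].
have := norm_sum_neighbours fgK x; rewrite !ler_norml => /andP[? ?].
by apply/andP; split; lra.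
Qed.

(** * The number of fresh sites *)

Definition fresh (R : realFieldType) (d : nat) (y : 'rV[int]_d.+1)
    (r : seq 'rV[int]_d.+1) : R := (y \notin r)%:R.

(* The expected number of fresh sites at the next [n] times, the present one
   included, for a walk now at [y] whose past, latest position first, is [r]. *)
Fixpoint newcount (R : realFieldType) (d : nat) (beta : R) (n : nat)
    (y : 'rV[int]_d.+1) (r : seq 'rV[int]_d.+1) : R :=
  if n is m.+1 then
    fresh R y r
      + step (fresh R y r * beta) (fun z => newcount beta m z (y :: r)) y
  else 0.

(* Bounds the expected number of discrepancies when the walk is at [y], the
   past up to the last change of shift is [s] and the sites visited since then
   are [r]. *)
Definition gap (R : realFieldType) (d : nat) (s : seq 'rV[int]_d.+1)
    (y : 'rV[int]_d.+1) (r : seq 'rV[int]_d.+1) : R :=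
  \sum_(b <- s) green R (lsq (y - b))
    * (2 + (\sum_(z <- r) green R (lsq (z - b))) / 9).

Lemma sum_green_ge0 (R : realFieldType) (d : nat) (r : seq 'rV[int]_d.+1)
    (b : 'rV[int]_d.+1) : 0 <= \sum_(z <- r) green R (lsq (z - b)).
Proof. by apply: sumr_ge0 => z _; exact: green_ge0. Qed.

Lemma gap_ge0 (R : realFieldType) (d : nat) (s r : seq 'rV[int]_d.+1)
    (y : 'rV[int]_d.+1) : 0 <= gap R s y r.
Proof.
apply: sumr_ge0 => b _; rewrite mulr_ge0 ?green_ge0 //.
by rewrite addr_ge0 // divr_ge0 ?sum_green_ge0.
Qed.

Lemma gapD_lsq0 (R : realFieldType) (d : nat) (s r : seq 'rV[int]_d.+1)
    (y c : 'rV[int]_d.+1) : lsq c = 0 -> gap R s (y + c) r = gap R s y r.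
Proof.
by move=> c0; apply: eq_bigr => b _; rewrite [y + c - b]addrAC (lsqD_eq0 _ c0).
Qed.

Lemma gap_nil (R : realFieldType) (d : nat) (s : seq 'rV[int]_d.+1)
    (y : 'rV[int]_d.+1) :
  gap R s y [::] = 2 * \sum_(b <- s) green R (lsq (y - b)).
Proof.
rewrite mulr_sumr; apply: eq_bigr => b _.
by rewrite big_nil mul0r addr0 mulrC.
Qed.

Lemma gap_nil_le (R : realFieldType) (d : nat) (s r : seq 'rV[int]_d.+1)
    (y : 'rV[int]_d.+1) : gap R s y [::] <= gap R s y r.
Proof.
apply: ler_sum => b _; apply: ler_wpM2l; first exact: green_ge0.
by rewrite big_nil mul0r addr0 lerDl divr_ge0 ?sum_green_ge0.
Qed.

(** Add [1 + h] times [avg_green_hit] to [avg_green_sqr]. The sum over the past grows by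
    [green R (lsq (y - b))], and the quadratic loss cancels exactly the resulting increase. *)
Lemma gap_cons_summand (R : realFieldType) (d : nat) (r : seq 'rV[int]_d.+1)
    (y b : 'rV[int]_d.+1) (h : R) : (8 <= d)%N ->
  h = (\sum_(z <- y :: r) green R (lsq (z - b))) / 9 ->
  (lsq (y - b) == 0)%:R * (1 + h)
    + avg (fun z => green R (lsq (z - b)) * (2 + h)) y
    <= green R (lsq (y - b)) * (2 + (\sum_(z <- r) green R (lsq (z - b))) / 9).
Proof.
move=> hd hE.
rewrite (eq_avg (g := fun z => (2 + h) * green R (lsq (z - b)))); last first.
  by move=> z; rewrite mulrC.
rewrite avgZ (avg_shift (fun z => green R (lsq z))).
have h0 : 0 <= 1 + h by rewrite hE addr_ge0 // divr_ge0 ?sum_green_ge0.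
have h1 := ler_wpM2l h0 (avg_green_hit R (y - b) hd).
have h2 := avg_green_sqr R (y - b) hd.
rewrite big_cons in hE.
move: h1; rewrite hE; lra.
Qed.

(** When the lateral path is back at a position of [s], the potential pays 1 for the discrepancy in
    freshness and one ninth of the sum for the possible new shift, after which all of [y :: r] joins
    [s]. *)
Lemma gap_step (R : realFieldType) (d : nat) (s r : seq 'rV[int]_d.+1)
    (y : 'rV[int]_d.+1) : (8 <= d)%N ->
  (has (fun b => lsq (y - b) == 0) s)%:R
      * (1 + (\sum_(z <- y :: r) green R (lsq (y - z))) / 9)
    + avg (fun z => gap R s z (y :: r)) y <= gap R s y r.
Proof.
move=> hd; rewrite avg_sum.
have h0 b : 0 <= 1 + (\sum_(z <- y :: r) green R (lsq (z - b))) / 9.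
  by rewrite addr_ge0 // divr_ge0 ?sum_green_ge0.
apply: (@le_trans _ _ (\sum_(b <- s) ((lsq (y - b) == 0)%:R
     * (1 + (\sum_(z <- y :: r) green R (lsq (z - b))) / 9)
   + avg (fun z => green R (lsq (z - b))
      * (2 + (\sum_(w <- y :: r) green R (lsq (w - b))) / 9)) y))); last first.
  by apply: ler_sum => b _; exact: (gap_cons_summand hd erefl).
rewrite [leRHS]big_split /= lerD2r.
case: hasP => [[b bs hb]|_]; last first.
  by rewrite mul0r sumr_ge0 // => b _; rewrite mulr_ge0.
(* One [b] laterally equal to [y] suffices, since the other terms are nonnegative; lateral distances
   to [b] and to [y] coincide. *)
rewrite mul1r (big_rem b bs) /= hb mul1r -[leLHS]addr0; apply: lerD.
  rewrite lerD2l ler_pM2r ?invr_gt0 //; apply: ler_sum => z _.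
  rewrite -lsqN opprB -(@lsqD_eq0 _ _ (y - b)) ?(eqP hb) //.
  by rewrite addrA subrK.
by apply: sumr_ge0 => z _; rewrite mulr_ge0.
Qed.

Lemma mem_shift (d : nat) (r : seq 'rV[int]_d.+1) (y c : 'rV[int]_d.+1) :
  (y + c \in [seq z + c | z <- r]) = (y \in r).
Proof. exact: (mem_map (@addIr _ c)). Qed.

(* The two walks have been parallel along [r]; only the lateral projection of
   the older part [s'] is controlled, by that of [s]. *)
Lemma newcount_coupling (R : realFieldType) (d : nat) (beta : R) :
  (8 <= d)%N -> 0 <= beta <= 1 ->
  forall (n : nat) (s s' r : seq 'rV[int]_d.+1) (y c : 'rV[int]_d.+1),
    lsq c = 0 ->
    (forall z, z \in s' -> exists2 w, w \in s & lsq (z - w) = 0) ->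
    `|newcount beta n y (r ++ s)
        - newcount beta n (y + c) ([seq z + c | z <- r] ++ s')| <= gap R s y r.
Proof.
move=> hd b01; elim=> [|n IH] s s' r y c c0 ss'.
  by rewrite subrr normr0 gap_ge0.
set f := fun z => newcount beta n z (y :: r ++ s).
set g := fun z =>
  newcount beta n (z + c) ((y + c) :: [seq z + c | z <- r] ++ s').
set K := fun z => gap R s z (y :: r).
have fgK z : `|f z - g z| <= K z by exact: (IH s s' (y :: r) z c).
have e0 : lsq (unitv ord0 : 'rV[int]_d.+1) = 0 by exact: lsq_unitv0.
have KE : K (y + unitv ord0) = K (y - unitv ord0).
  by rewrite /K !gapD_lsq0 // lsqN.
have K0 : K (y + unitv ord0) = gap R s y (y :: r) by rewrite /K gapD_lsq0.
have shiftE gamma : step gamma (fun z => newcount beta n z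
    ((y + c) :: [seq z + c | z <- r] ++ s')) (y + c) = step gamma g y.
  by rewrite /step -avg_shift /g [y + c + _]addrAC [y + c - _]addrAC.
rewrite /= !shiftE -/f.
(* Away from the lateral positions of [s] only the parallel stretch [r] decides freshness, so both
   walks agree on it. *)
have yN : ~~ has (fun b => lsq (y - b) == 0) s ->
    (y \in r ++ s = (y \in r)) *
    (y + c \in [seq z + c | z <- r] ++ s' = (y \in r)).
  move=> nh; rewrite !mem_cat mem_shift; split.
    case: (boolP (y \in s)) => [ys|]; last by rewrite orbF.
    by case/hasP: nh; exists y; rewrite // subrr lsq0.
  case: (boolP (y + c \in s')) => [ys|]; last by rewrite orbF.
  case: (ss' _ ys) => w ws hw; case/hasP: nh; exists w => //.
  by rewrite addrAC lsqD_eq0 // in hw; rewrite hw.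
apply: le_trans (gap_step R s r y hd).
case: (boolP (has _ s)) => [_|/yN [y1 y2]]; last first.
  rewrite mul0r add0r /fresh y1 y2.
  rewrite opprD addrACA subrr add0r.
  apply: step_contract => //.
  case: (_ \notin _); rewrite ?mul1r ?mul0r //=.
  by rewrite lexx ler01.
rewrite mul1r.
set m := (\sum_(z <- y :: r) _) / 9.
have m0 : 0 <= m.
  rewrite /m divr_ge0 //; apply: sumr_ge0 => z _; exact: green_ge0.
(* After opposite steps the shift changes and the whole past joins [s]. *)
have cross (e : 'rV[int]_d.+1) : lsq e = 0 ->
    `|f (y + e) - g (y - e)| <= gap R ((y :: r) ++ s) y [::].
  move=> eE; rewrite /f /g.
  have -> : y - e + c = y + e + (c - e - e).
    by apply/rowP => i; rewrite !mxE; ring.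
  rewrite -(gapD_lsq0 R (y :: r ++ s) [::] y eE).
  apply: (IH _ _ [::]) => [|z].
    by rewrite !lsqD_eq0 // lsqN.
  rewrite in_cons mem_cat => /or3P[/eqP ->|/mapP[w wr ->]|zs'].
  - by exists y; rewrite ?mem_head // addrAC subrr add0r.
  - exists w; first by rewrite in_cons mem_cat wr orbT.
    by rewrite addrAC subrr add0r.
  - have [w ws hw] := ss' z zs'; exists w => //.
    by rewrite in_cons mem_cat ws !orbT.
(* Opposite steps have weight at most [1 / 18], because [beta <= 1] and the dimension is at least 9.
   They raise [gap] by at most twice the sum over [y :: r], that is [18 * m], so their total cost is
   at most [m]. *)
have [b0 b1] := andP b01.
have hB : beta / (2 * d.+1%:R) * (gap R ((y :: r) ++ s) y [::]
    - K (y + unitv ord0)) <= m.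
  have le18 : beta / (2 * d.+1%:R) <= 1 / 18.
    rewrite ler_pdivrMr ?mulr_gt0 //.
    have : 9 <= d.+1%:R :> R by rewrite ler_nat.
    by lra.
  have coef0 : 0 <= beta / (2 * d.+1%:R) by rewrite divr_ge0 ?mulr_ge0.
  have le_m : gap R ((y :: r) ++ s) y [::] - K (y + unitv ord0) <= 18 * m.
    have := gap_nil_le R s (y :: r) y.
    by rewrite K0 !gap_nil big_cat /= /m; lra.
  apply: le_trans (ler_wpM2l coef0 le_m) _.
  apply: le_trans (ler_wpM2r _ le18) _; lra.
have cross0 := cross _ e0.
have hD a b : a <= 1 -> b <= avg K y + m -> a + b <= 1 + m + avg K y by lra.
rewrite opprD addrACA.
apply: le_trans (ler_normD _ _) _.
have H : `|step beta f y - step 0 g y| <= avg K y + m.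
  by apply: le_trans (step_coupling b01 fgK KE cross0) _; rewrite lerD2l.
have H' : `|step 0 f y - step beta g y| <= avg K y + m.
  rewrite distrC; apply: le_trans (step_coupling b01 _ KE _) _.
  - by move=> z; rewrite distrC.
  - rewrite distrC; have := cross (- unitv ord0); rewrite lsqN opprK => h.
    exact: h.
  - by rewrite lerD2l.
have S gamma : 0 <= gamma <= 1 ->
    `|step gamma f y - step gamma g y| <= avg K y + m.
  by move=> h; apply: le_trans (step_contract h fgK KE) _; rewrite lerDl.
(* The fresh indicators differ by at most 1; the four combinations of fresh and visited are covered
   by [H], [H'] and the two equal-excitement cases of [S]. *)
apply: hD.
  by rewrite /fresh; do 2![case: (_ \notin _)];
    rewrite ?subrr ?subr0 ?sub0r ?normrN ?normr0 ?normr1.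
rewrite /fresh; do 2![case: (_ \notin _)]; rewrite ?mul0r ?mul1r //.
  exact: S.
apply: S.
by rewrite lexx ler01.
Qed.

(** The part with [green] absorbs the losses from revisits, and the part with [green2] those from
    [newcount_coupling] when the current step changes from [beta1] to [beta2]. *)
Definition drift_potential (R : realFieldType) (d : nat)
    (r : seq 'rV[int]_d.+1) (y : 'rV[int]_d.+1) : R :=
  \sum_(z <- r) (2 * green R (lsq (y - z))
                 + 2 / d.+1%:R * green2 R (lsq (y - z))).

Lemma fresh_ge (R : realFieldType) (d : nat) (y : 'rV[int]_d.+1)
    (r : seq 'rV[int]_d.+1) :
  1 - \sum_(z <- r) (lsq (y - z) == 0)%:R <= fresh R y r.
Proof.
rewrite /fresh; case: (boolP (y \in r)) => [yr|_] /=.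
  rewrite (big_rem y yr) /= subrr lsq0 eqxx opprD addrA subrr add0r oppr_le0.
  by apply: sumr_ge0.
by rewrite gerBl; apply: sumr_ge0.
Qed.

(** Every past site contributes a supermartingale. The present site newly enters the potential; with
    [t] for [2 / d.+1%:R], its cost is at most [1 + 7 t / 2], which is at most [16 / 9] since
    [t <= 2 / 9]. *)
Lemma drift_potential_step (R : realFieldType) (d : nat)
    (r : seq 'rV[int]_d.+1) (y : 'rV[int]_d.+1) : (8 <= d)%N ->
  2 * \sum_(z <- r) (lsq (y - z) == 0)%:R
    + 2 / d.+1%:R * \sum_(z <- y :: r) green R (lsq (y - z))
    + avg (drift_potential R (y :: r)) y
    <= drift_potential R r y + 16 / 9.
Proof.
move=> hd.
set t : R := 2 / d.+1%:R.
have t0 : 0 <= t by rewrite divr_ge0.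
have t29 : t <= 2 / 9.
  by rewrite ler_pdivrMr // mulrAC ler_pdivlMr // ler_pM2l // ler_nat.
have avgE z : avg (fun w => 2 * green R (lsq (w - z))
    + t * green2 R (lsq (w - z))) y
  = 2 * avg (fun w => green R (lsq w)) (y - z)
    + t * avg (fun w => green2 R (lsq w)) (y - z).
  by rewrite avgD !avgZ (avg_shift (fun w => green R (lsq w)))
    (avg_shift (fun w => green2 R (lsq w))).
rewrite [drift_potential R (y :: r)](_ : _ = fun w => \sum_(z <- y :: r)
  (2 * green R (lsq (w - z)) + t * green2 R (lsq (w - z)))) //.
rewrite avg_sum !big_cons subrr avgE subrr.
have hz (z : 'rV[int]_d.+1) : 2 * (lsq z == 0)%:R + t * green R (lsq z)
    + (2 * avg (fun w => green R (lsq w)) z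
       + t * avg (fun w => green2 R (lsq w)) z)
    <= 2 * green R (lsq z) + t * green2 R (lsq z).
  have := avg_green_hit R z hd.
  have := ler_wpM2l t0 (avg_green2 R z hd).
  by lra.
have hr : \sum_(z <- r) (2 * (lsq (y - z) == 0)%:R + t * green R (lsq (y - z))
    + avg (fun w => 2 * green R (lsq (w - z)) + t * green2 R (lsq (w - z))) y)
  <= drift_potential R r y.
  by apply: ler_sum => z _; rewrite avgE; exact: hz.
have := hz 0; rewrite lsq0 green_0 green2_0 eqxx /=.
move: hr; rewrite 2!big_split /= -!mulr_sumr.
by lra.
Qed.

(* Duhamel: compare one step at a time, the first steps taken with [beta2] and
   the later ones with [beta1]; [newcount_coupling] bounds what is lost. *)
Lemma newcount_growth (R : realFieldType) (d : nat) (beta1 beta2 : R) :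
  (8 <= d)%N -> 0 <= beta1 -> beta1 <= beta2 -> beta2 <= 1 ->
  forall (n : nat) (y : 'rV[int]_d.+1) (r : seq 'rV[int]_d.+1),
    (beta2 - beta1) / 2 * (n%:R * (2 / 9) - drift_potential R r y)
      <= beta2 * newcount beta2 n y r - beta1 * newcount beta1 n y r.
Proof.
move=> hd b1 b12 b2.
have b0 : 0 <= (beta2 - beta1) / 2 by rewrite divr_ge0 // subr_ge0.
have pot0 (r : seq 'rV[int]_d.+1) y : 0 <= drift_potential R r y.
  apply: sumr_ge0 => z _.
  apply: addr_ge0; apply: mulr_ge0; rewrite ?divr_ge0 ?green2_ge0 //.
  exact: green_ge0.
elim=> [|n IH] y r.
  by rewrite /= !mulr0 mul0r sub0r subr0 mulrN oppr_le0 mulr_ge0.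
rewrite [leRHS]/=.
set f1 := fun z => newcount beta1 n z (y :: r).
set f2 := fun z => newcount beta2 n z (y :: r).
set F := fresh R y r.
have F01 : 0 <= F <= 1.
  by rewrite /F /fresh; case: (_ \notin _); rewrite ?lexx ?ler01.
have [F0 F1] := andP F01.
have b20 : 0 <= beta2 by apply: le_trans b12.
have e0 : lsq (unitv ord0 : 'rV[int]_d.+1) = 0 by exact: lsq_unitv0.
have eN : lsq (- unitv ord0 : 'rV[int]_d.+1) = 0 by rewrite lsqN.
set S := \sum_(z <- y :: r) green R (lsq (y - z)).
have S0 : 0 <= S by apply: sumr_ge0 => z _; exact: green_ge0.
(* Three effects: the direct gain at a fresh site, the later difference seen along a [beta2] step,
   and the change of the current step in front of a [beta1] future. *)
have -> : beta2 * (F + step (F * beta2) f2 y)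
    - beta1 * (F + step (F * beta1) f1 y)
  = (beta2 - beta1) * F
    + step (F * beta2) (fun z => beta2 * f2 z - beta1 * f1 z) y
    + (F * beta1) * ((beta2 - beta1) / (2 * d.+1%:R))
      * (f1 (y + unitv ord0) - f1 (y - unitv ord0)).
  rewrite /step.
  have -> : avg (fun z => beta2 * f2 z - beta1 * f1 z) y
      = beta2 * avg f2 y - beta1 * avg f1 y.
    rewrite -mulNr -!avgZ -avgD; apply: eq_avg => z; ring.
  ring.
have hstep : avg (fun z => (beta2 - beta1) / 2
      * (n%:R * (2 / 9) - drift_potential R (y :: r) z)) y
   <= step (F * beta2) (fun z => beta2 * f2 z - beta1 * f1 z) y.
  apply: step_ge => [|z|]; last 2 first.
  - exact: IH.
  - congr (_ * (_ - _)); apply: eq_bigr => z _.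
    by rewrite ![y + _ - z]addrAC !(lsqD_eq0 _ e0) !(lsqD_eq0 _ eN).
  by rewrite mulr_ge0 //= mulr_ile1.
(* The two futures share the past [y :: r] and start with shift [-2 e_1], so [gap] with no parallel
   stretch bounds their difference. *)
have hcross : - (2 * S) <= f1 (y + unitv ord0) - f1 (y - unitv ord0).
  have b1' : 0 <= beta1 <= 1 by rewrite b1 (le_trans b12).
  have c0 : lsq (- unitv ord0 - unitv ord0 : 'rV[int]_d.+1) = 0.
    by rewrite lsqD_eq0.
  have := newcount_coupling hd b1' (s := y :: r) (s' := y :: r) n [::]
    (y + unitv ord0) c0.
  rewrite gapD_lsq0 // gap_nil addrA addrK => h.
  have {}h : `|f1 (y + unitv ord0) - f1 (y - unitv ord0)| <= 2 * S.
    by apply: h => z zr; exists z; rewrite // subrr lsq0.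
  by move: h; rewrite ler_norml => /andP[].
have hcross' : - ((beta2 - beta1) / 2 * (2 / d.+1%:R * S))
    <= (F * beta1) * ((beta2 - beta1) / (2 * d.+1%:R))
      * (f1 (y + unitv ord0) - f1 (y - unitv ord0)).
  have c0 : 0 <= (beta2 - beta1) / (2 * d.+1%:R).
    by rewrite divr_ge0 ?mulr_ge0 // subr_ge0.
  have Fb0 : 0 <= F * beta1 by rewrite mulr_ge0.
  have Fb1 : F * beta1 <= 1 by rewrite mulr_ile1 // (le_trans b12).
  have -> : - ((beta2 - beta1) / 2 * (2 / d.+1%:R * S))
     = - ((beta2 - beta1) / (2 * d.+1%:R) * (2 * S)).
    by field; rewrite nat1r pnatr_eq0.
  rewrite -[leRHS]mulrA.
  apply: le_trans (ler_wpM2l Fb0 (ler_wpM2l c0 hcross)).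
  rewrite !mulrN lerN2; apply: ler_piMl => //.
  by apply: mulr_ge0 => //; apply: mulr_ge0.
have hF := fresh_ge R y r; rewrite -/F in hF.
have hpot := drift_potential_step R r y hd; rewrite -/S in hpot.
rewrite avgZ avgD avg_const in hstep.
move: hstep; rewrite (eq_avg (g := fun z => -1 * drift_potential R (y :: r) z));
  last by move=> z; rewrite mulN1r.
rewrite avgZ => hstep.
(* In units of [(beta2 - beta1) / 2] the direct gain is [2 F]; after the revisits and the shift are
   charged to the potential, [2 - 16 / 9 = 2 / 9] remains per step. *)
have hF' := ler_wpM2l b0 hF.
have hpot' := ler_wpM2l b0 hpot.
rewrite -[n.+1%:R]natr1.
move: hcross' hF' hpot' hstep; clear.
move: (F * beta1 * _ * _) (step _ _ _) (avg _ _) (drift_potential _ _ _).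
move: (2 / d.+1%:R * S) (\sum_(z <- r) _) => t u X T A P.
by lra.
Qed.

(** * The law of the walk *)

Definition unitvs (d : nat) : seq 'rV[int]_d.+1 :=
  [seq unitv i | i <- index_enum 'I_d.+1]
    ++ [seq - unitv i | i <- index_enum 'I_d.+1].

Lemma dot_unitv (d : nat) (i : 'I_d.+1) (x : 'rV[int]_d.+1) :
  dot x (unitv i) = x ord0 i.
Proof.
rewrite /dot (bigD1 i) //= big1 => [|j ji]; rewrite !mxE.
  by rewrite !eqxx mulr1 addr0.
by rewrite (negPf ji) andbF mulr0.
Qed.

Lemma dotN (d : nat) (x y : 'rV[int]_d.+1) : dot x (- y) = - dot x y.
Proof. by rewrite /dot -sumrN; apply: eq_bigr => i _; rewrite mxE mulrN. Qed.

Lemma dotC (d : nat) (x y : 'rV[int]_d.+1) : dot x y = dot y x.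
Proof. by apply: eq_bigr => i _; rewrite mulrC. Qed.

(** A sum of integer squares equals 1 only if one coordinate is 1 or -1 and the others vanish. *)
Lemma mem_unitvs (d : nat) (x : 'rV[int]_d.+1) :
  (x \in unitvs d) = (dot x x == 1).
Proof.
apply/idP/eqP => [|x1].
  rewrite mem_cat => /orP[] /mapP[i _ ->].
    by rewrite dot_unitv mxE !eqxx.
  by rewrite dotN dot_unitv !mxE !eqxx opprK.
have [i xi] : exists i, x ord0 i != 0.
  apply/existsP; apply: contraPT x1 => /existsPn x0.
  rewrite /dot big1 // => i _; have := x0 i; rewrite negbK => /eqP ->.
  by rewrite mulr0.
have sq_ge0 j : 0 <= x ord0 j * x ord0 j by rewrite -expr2 sqr_ge0.
move: x1; rewrite /dot (bigD1 i) //= => x1.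
have rest0 : 0 <= \sum_(j < d.+1 | j != i) x ord0 j * x ord0 j.
  by apply: sumr_ge0 => j _; exact: sq_ge0.
have xi1 : 1 <= x ord0 i * x ord0 i.
  by rewrite -gtz0_ge1 lt_def mulf_neq0 ?sq_ge0.
have sum0 : \sum_(j < d.+1 | j != i) x ord0 j * x ord0 j = 0.
  by move: rest0 xi1 x1; move: (\sum_(_ < _ | _) _) (_ * _) => a b; lia.
have xj0 j : j != i -> x ord0 j = 0.
  move=> ji; apply/eqP; rewrite -sqrf_eq0 expr2.
  move/eqP: sum0; rewrite psumr_eq0 // => /allP/(_ j).
  by rewrite mem_index_enum ji => /(_ isT).
have /orP[/eqP xi'|/eqP xi'] : (x ord0 i == 1) || (x ord0 i == -1).
  by rewrite -sqrf_eq1 expr2; apply/eqP; move: x1; rewrite sum0 addr0.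
- rewrite mem_cat; apply/orP; left.
  apply/mapP; exists i; first by rewrite mem_index_enum.
  apply/rowP => j; rewrite mxE eqxx /=.
  by case: (eqVneq j i) => [->|/xj0].
- rewrite mem_cat; apply/orP; right.
  apply/mapP; exists i; first by rewrite mem_index_enum.
  apply/rowP => j; rewrite !mxE eqxx /=.
  by case: (eqVneq j i) => [->|/xj0] //; rewrite oppr0.
Qed.

Lemma unitvs_uniq (d : nat) : uniq (unitvs d).
Proof.
have inj : injective (@unitv d).
  move=> i j /rowP/(_ i); rewrite !mxE !eqxx /=.
  by case: (eqVneq i j).
rewrite cat_uniq; apply/and3P; split.
- by rewrite map_inj_uniq ?index_enum_uniq.
- apply/hasPn => x /mapP[i _ ->]; apply/mapP => -[j _ /rowP/(_ i)].
  by rewrite !mxE !eqxx /=; case: eqP.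
- by rewrite map_inj_uniq ?index_enum_uniq // => i j /oppr_inj/inj.
Qed.

Lemma sum_unitvs (R : realFieldType) (d : nat) (f : 'rV[int]_d.+1 -> R) :
  \sum_(v <- unitvs d) f v = \sum_(i < d.+1) (f (unitv i) + f (- unitv i)).
Proof. by rewrite big_split big_cat !big_map. Qed.

Lemma step_prob_unitv (R : realType) (d : nat) (gamma : R) (i : 'I_d.+1) :
  step_prob gamma (unitv i) = (1 + gamma * (i == ord0)%:R) / (2 * d.+1%:R).
Proof.
rewrite /step_prob -mem_unitvs ifT; last first.
  by rewrite mem_cat map_f ?mem_index_enum.
by rewrite dotC dot_unitv !mxE eqxx eq_sym; case: eqP.
Qed.

Lemma step_prob_unitvN (R : realType) (d : nat) (gamma : R) (i : 'I_d.+1) :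
  step_prob gamma (- unitv i) = (1 - gamma * (i == ord0)%:R) / (2 * d.+1%:R).
Proof.
rewrite /step_prob -mem_unitvs ifT; last first.
  by rewrite mem_cat (map_f (fun i => - unitv i)) ?mem_index_enum ?orbT.
rewrite dotN dotC dot_unitv !mxE eqxx eq_sym.
by case: eqP; rewrite ?mulrN1z ?mulr0 ?oppr0 ?mulrN.
Qed.

(** Identifies [step] as the transition operator of the step law [step_prob]. *)
Lemma sum_step_prob (R : realType) (d : nat) (gamma : R)
    (g : 'rV[int]_d.+1 -> R) (y : 'rV[int]_d.+1) :
  \sum_(v <- unitvs d) step_prob gamma v * g (y + v) = step gamma g y.
Proof.
rewrite sum_unitvs /step /avg [in RHS]mulr_suml.
rewrite big_ord_recl [in RHS]big_ord_recl.
rewrite !step_prob_unitv !step_prob_unitvN eqxx /= mulr1 -!addrA.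
have -> : \sum_(i < d)
      (step_prob gamma (unitv (lift ord0 i)) * g (y + unitv (lift ord0 i))
      + step_prob gamma (- unitv (lift ord0 i)) * g (y - unitv (lift ord0 i)))
  = \sum_(i < d) (g (y + unitv (lift ord0 i)) + g (y - unitv (lift ord0 i)))
      / (2 * d.+1%:R).
  apply: eq_bigr => i _; rewrite step_prob_unitv step_prob_unitvN.
  rewrite (_ : (lift ord0 i == ord0) = false) //= mulr0; ring.
ring.
Qed.

(* Nearest-neighbour paths from the origin: the endpoint, and the earlier
   positions with the latest first. *)
Fixpoint paths (d : nat) (n : nat) : seq ('rV[int]_d.+1 * seq 'rV[int]_d.+1) :=
  if n is m.+1 then
    [seq (p.1 + v, p.1 :: p.2) | p <- paths d m, v <- unitvs d]
  else [:: (0, [::])].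

Lemma size_paths (d n : nat) (p : 'rV[int]_d.+1 * seq 'rV[int]_d.+1) :
  p \in paths d n -> size p.2 = n.
Proof.
elim: n p => [|n IH] p /=; first by rewrite inE => /eqP ->.
by case/allpairsP => -[q v] /= [/IH <- _ ->].
Qed.

Lemma sum_paths (R : realFieldType) (d n : nat)
    (F : 'rV[int]_d.+1 * seq 'rV[int]_d.+1 -> R) :
  \sum_(p <- paths d n.+1) F p
    = \sum_(p <- paths d n) \sum_(v <- unitvs d) F (p.1 + v, p.1 :: p.2).
Proof. by rewrite /= big_allpairs_dep. Qed.

(** * Cylinder events and expectations over finite paths *)

Definition trace (T : Type) (d : nat) (omega : nat -> T -> 'rV[int]_d.+1)
    (n : nat) (t : T) : seq 'rV[int]_d.+1 := rev (mkseq (omega ^~ t) n).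

Definition cylinder (T : Type) (d : nat) (omega : nat -> T -> 'rV[int]_d.+1)
    (n : nat) (p : 'rV[int]_d.+1 * seq 'rV[int]_d.+1) : set T :=
  [set t | (omega n t, trace omega n t) = p].

Lemma traceS (T : Type) (d : nat) (omega : nat -> T -> 'rV[int]_d.+1)
    (n : nat) (t : T) : trace omega n.+1 t = omega n t :: trace omega n t.
Proof. by rewrite /trace mkseqS rev_rcons. Qed.

Lemma cylinder_cons (T : Type) (d : nat) (omega : nat -> T -> 'rV[int]_d.+1)
    (n : nat) (x : 'rV[int]_d.+1) (p : 'rV[int]_d.+1 * seq 'rV[int]_d.+1) :
  cylinder omega n.+1 (x, p.1 :: p.2)
    = omega n.+1 @^-1` [set x] `&` cylinder omega n p.
Proof.
apply/seteqP; rewrite /cylinder; split => t /=; rewrite traceS.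
  by case: p => y r [-> -> ->].
by case: p => y r [-> [-> ->]].
Qed.

Lemma measurable_cylinder (disp : measure_display) (T : measurableType disp)
    (d : nat) (omega : nat -> T -> 'rV[int]_d.+1) :
  (forall n x, measurable (omega n @^-1` [set x])) ->
  forall n p, measurable (cylinder omega n p).
Proof.
move=> mo; elim=> [|n IH] [y r].
  case: r => [|z r].
    rewrite (_ : cylinder _ _ _ = omega 0%N @^-1` [set y]) //.
    by apply/seteqP; rewrite /cylinder; split => t /= => [[]|->].
  rewrite (_ : cylinder _ _ _ = set0) //.
  by apply/seteqP; rewrite /cylinder; split => t.
case: r => [|z r].
  rewrite (_ : cylinder _ _ _ = set0) //.
  by apply/seteqP; rewrite /cylinder; split => t //=; rewrite traceS.
by rewrite (cylinder_cons _ _ _ (z, r)); apply: measurableI.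
Qed.

(** Passes from sequences of positions to lists with the latest first. The default value of [nth] is
    harmless, as [history] reads only the times up to [n]. *)
Lemma history_cylinder (T : Type) (d : nat)
    (omega : nat -> T -> 'rV[int]_d.+1) (n : nat) (y : 'rV[int]_d.+1)
    (r : seq 'rV[int]_d.+1) : size r = n ->
  history omega (nth 0 (rev (y :: r))) n = cylinder omega n (y, r).
Proof.
move=> rn; have sz : size (rev (y :: r)) = n.+1 by rewrite size_rev /= rn.
apply/seteqP; rewrite /history /cylinder; split => t /= h.
  have /(congr1 rev) : mkseq (omega ^~ t) n.+1 = rev (y :: r).
    rewrite -[RHS](mkseq_nth 0) sz; apply/eq_in_map => k.
    by rewrite mem_iota add0n ltnS => /h.
  by rewrite revK -/(trace _ _ _) traceS => -[-> ->].
move=> k kn; case: h => h1 h2.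
by rewrite -h1 -h2 -traceS /trace revK nth_mkseq.
Qed.

Lemma new_site_rev (d : nat) (n : nat) (y : 'rV[int]_d.+1)
    (r : seq 'rV[int]_d.+1) : size r = n ->
  new_site (nth 0 (rev (y :: r))) n = (y \notin r).
Proof.
move=> rn; rewrite /new_site rev_cons nth_rcons size_rev rn ltnn eqxx.
congr (~~ _); rewrite -[RHS]mem_rev; congr (_ \in _).
rewrite -[RHS](mkseq_nth 0) size_rev rn; apply/eq_in_map => k.
by rewrite mem_iota add0n nth_rcons size_rev rn => /andP[_ ->].
Qed.

Lemma cylinder_prob_cons (R : realType) (d : nat) (beta : R)
    (disp : measure_display) (T : measurableType disp) (P : probability T R)
    (omega : nat -> T -> 'rV[int]_d.+1) :
  is_ERW beta P omega ->
  forall (n : nat) (p : 'rV[int]_d.+1 * seq 'rV[int]_d.+1) (v : 'rV[int]_d.+1),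
  size p.2 = n ->
  fine (P (cylinder omega n.+1 (p.1 + v, p.1 :: p.2)))
    = fine (P (cylinder omega n p)) * step_prob (fresh R p.1 p.2 * beta) v.
Proof.
case=> mo _ h n [y r] v /= rn.
have mc := measurable_cylinder mo.
have E : cylinder omega n.+1 (y + v, y :: r)
    = [set t | omega n.+1 t = omega n t + v] `&` cylinder omega n (y, r).
  rewrite (cylinder_cons _ _ _ (y, r)); apply/seteqP; rewrite /cylinder.
  by split => t /= [a [b c]]; split; rewrite ?b ?c // a b.
(* On a null cylinder the conditional law says nothing, but both sides vanish. *)
have [P0|P0] := eqVneq (P (cylinder omega n (y, r))) 0%E.
  rewrite P0 mul0r (_ : P _ = 0%E) //.
  by apply: subset_measure0 P0 => //; rewrite E; apply: subIsetr.
have Ppos : (0 < P (cylinder omega n (y, r)))%E by rewrite lt0e P0 measure_ge0.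
have := h n (nth 0 (rev (y :: r))) v.
rewrite history_cylinder // => /(_ Ppos).
rewrite /cond_prob -E new_site_rev // => hc.
have -> : fresh R y r * beta = if y \notin r then beta else 0.
  by rewrite /fresh; case: ifP; rewrite ?mul1r ?mul0r.
rewrite -hc mulrCA divff ?mulr1 //.
by rewrite fine_eq0 // fin_num_measure.
Qed.

(** A finite sum that serves as the expectation of [G], because the nearest-neighbour paths carry
    all the mass. *)
Definition path_mean (R : realType) (d : nat) (disp : measure_display)
    (T : measurableType disp) (P : probability T R)
    (omega : nat -> T -> 'rV[int]_d.+1) (n : nat)
    (G : 'rV[int]_d.+1 * seq 'rV[int]_d.+1 -> R) : R :=
  \sum_(p <- paths d n) fine (P (cylinder omega n p)) * G p.

Lemma path_meanS (R : realType) (d : nat) (beta : R)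
    (disp : measure_display) (T : measurableType disp) (P : probability T R)
    (omega : nat -> T -> 'rV[int]_d.+1) : is_ERW beta P omega ->
  forall (n : nat) (G : 'rV[int]_d.+1 * seq 'rV[int]_d.+1 -> R),
  path_mean P omega n.+1 G = path_mean P omega n (fun p =>
    step (fresh R p.1 p.2 * beta) (fun z => G (z, p.1 :: p.2)) p.1).
Proof.
move=> erw n G; rewrite /path_mean sum_paths.
apply: eq_big_seq => p /size_paths sp.
rewrite -sum_step_prob mulr_sumr; apply: eq_bigr => v _.
by rewrite (cylinder_prob_cons erw) // mulrA.
Qed.

Lemma path_mean0 (R : realType) (d : nat) (beta : R)
    (disp : measure_display) (T : measurableType disp) (P : probability T R)
    (omega : nat -> T -> 'rV[int]_d.+1) : is_ERW beta P omega ->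
  forall G : 'rV[int]_d.+1 * seq 'rV[int]_d.+1 -> R,
  path_mean P omega 0 G = G (0, [::]).
Proof.
case=> _ o0 _ G; rewrite /path_mean big_seq1.
rewrite (_ : cylinder _ _ _ = setT) ?probability_setT ?mul1r //.
by apply/seteqP; split => t //= _; rewrite /cylinder /= o0.
Qed.

Lemma path_mean_cst (R : realType) (d : nat) (beta : R)
    (disp : measure_display) (T : measurableType disp) (P : probability T R)
    (omega : nat -> T -> 'rV[int]_d.+1) : is_ERW beta P omega ->
  forall n : nat, path_mean P omega n (fun=> 1) = 1.
Proof.
move=> erw; elim=> [|n IH]; first by rewrite (path_mean0 erw).
rewrite (path_meanS erw) -[RHS]IH; apply: eq_bigr => p _; congr (_ * _).
by rewrite /step avg_const subrr mulr0 addr0.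
Qed.

Lemma avg_coord (R : realType) (d : nat) (y : 'rV[int]_d.+1) :
  avg (fun z => (z ord0 ord0)%:~R : R) y = (y ord0 ord0)%:~R.
Proof.
rewrite -[RHS](avg_const _ y) /avg; congr (_ / _).
by apply: eq_bigr => i _; rewrite !mxE rmorphD rmorphB /=; ring.
Qed.

Lemma path_mean_coord (R : realType) (d : nat) (beta : R)
    (disp : measure_display) (T : measurableType disp) (P : probability T R)
    (omega : nat -> T -> 'rV[int]_d.+1) : is_ERW beta P omega ->
  forall n : nat, path_mean P omega n (fun p => (p.1 ord0 ord0)%:~R)
    = beta / d.+1%:R * newcount beta n (0 : 'rV[int]_d.+1) [::].
Proof.
move=> erw n.
(* With [m] the number of remaining steps, the coordinate plus [beta / d.+1%:R] times the expected
   future fresh sites has a mean depending only on [n + m]: a fresh site moves the mean by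
   [beta / d.+1%:R]. *)
suff H m : path_mean P omega n (fun p => (p.1 ord0 ord0)%:~R
      + beta / d.+1%:R * newcount beta m p.1 p.2)
    = beta / d.+1%:R * newcount beta (n + m) (0 : 'rV[int]_d.+1) [::].
  rewrite -[n in RHS]addn0 -H; apply: eq_bigr => p _.
  by rewrite /= mulr0 addr0.
elim: n m => [|n IH] m; first by rewrite (path_mean0 erw) /= mxE add0r.
rewrite (path_meanS erw) addSnnS -IH; apply: eq_bigr => p _; congr (_ * _).
rewrite [newcount _ m.+1 _ _]/= /step avgD avgZ avg_coord !mxE !eqxx /=.
rewrite !rmorphD rmorphN /=.
by field; rewrite nat1r pnatr_eq0.
Qed.

(** * Random variables depending on finitely many steps *)

Definition nn_path (T : Type) (d : nat) (omega : nat -> T -> 'rV[int]_d.+1)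
    (n : nat) (t : T) : Prop :=
  forall k, (k < n)%N -> omega k.+1 t - omega k t \in unitvs d.

Lemma nn_cylinder (T : Type) (d : nat) (omega : nat -> T -> 'rV[int]_d.+1)
    (n : nat) (p : 'rV[int]_d.+1 * seq 'rV[int]_d.+1) (t : T) :
  p \in paths d n -> cylinder omega n p t -> nn_path omega n t.
Proof.
elim: n p => [|n IH] p //= /allpairsP[[q v] /= [qn vn ->]].
rewrite cylinder_cons => -[/= hv hq] k.
rewrite ltnS leq_eqVlt => /orP[/eqP ->|].
  rewrite hv; move: hq; rewrite /cylinder /= => <-.
  by rewrite addrAC subrr add0r.
exact: IH qn hq k.
Qed.

(** A simple function equal to [G] of the path on nearest-neighbour paths and to 0 elsewhere; its
    integral is a finite sum. *)
Definition path_rv (R : realType) (T : Type) (d : nat)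
    (omega : nat -> T -> 'rV[int]_d.+1) (n : nat)
    (G : 'rV[int]_d.+1 * seq 'rV[int]_d.+1 -> R) (t : T) : R :=
  \sum_(p <- paths d n) G p * \1_(cylinder omega n p) t.

Lemma path_rv_nn (R : realType) (T : Type) (d : nat)
    (omega : nat -> T -> 'rV[int]_d.+1) (n : nat)
    (G : 'rV[int]_d.+1 * seq 'rV[int]_d.+1 -> R) (t : T) :
  omega 0%N t = 0 -> nn_path omega n t ->
  path_rv omega n G t = G (omega n t, trace omega n t).
Proof.
move=> o0; elim: n G => [|n IH] G nn; rewrite /path_rv.
  rewrite big_seq1 indicE mem_set ?o0 ?mulr1 //=.
  by rewrite /cylinder /= o0.
rewrite sum_paths.
have nn' : nn_path omega n t by move=> k kn; apply: nn; apply: ltnW.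
(* Summing over the last step first reduces the claim to paths of length [n]. *)
pose G' (p : 'rV[int]_d.+1 * seq 'rV[int]_d.+1) : R :=
  \sum_(v <- unitvs d) G (p.1 + v, p.1 :: p.2) * (omega n.+1 t == p.1 + v)%:R.
transitivity (path_rv omega n G' t).
  apply: eq_bigr => p _; rewrite mulr_suml; apply: eq_bigr => v _.
  rewrite -mulrA; congr (_ * _); rewrite cylinder_cons indicI /=.
  congr (_ * _); rewrite indicE; congr ((nat_of_bool _)%:R).
  by apply/idP/eqP; rewrite inE.
rewrite IH // /G' /= traceS.
have := nn n (ltnSn n) => mem.
rewrite (big_rem _ mem) /= [omega n t + _]addrC subrK eqxx mulr1.
rewrite big_seq big1 ?addr0 // => v.
rewrite mem_rem_uniq ?unitvs_uniq // => /andP[/= ne _].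
rewrite (_ : (_ == _) = false) ?mulr0 //.
by apply: contraNF ne => /eqP ->; rewrite addrAC subrr add0r.
Qed.

Lemma path_rv_not_nn (R : realType) (T : Type) (d : nat)
    (omega : nat -> T -> 'rV[int]_d.+1) (n : nat)
    (G : 'rV[int]_d.+1 * seq 'rV[int]_d.+1 -> R) (t : T) :
  ~ nn_path omega n t -> path_rv omega n G t = 0.
Proof.
move=> nn; rewrite /path_rv big_seq big1 // => p pn.
rewrite indicE memNset ?mulr0 // => /(nn_cylinder pn).
exact: nn.
Qed.

Lemma integrable_path_term (R : realType) (d : nat) (disp : measure_display)
    (T : measurableType disp) (P : probability T R)
    (omega : nat -> T -> 'rV[int]_d.+1) :
  (forall n x, measurable (omega n @^-1` [set x])) ->
  forall n (G : 'rV[int]_d.+1 * seq 'rV[int]_d.+1 -> R) p,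
  P.-integrable setT (fun t => (G p * \1_(cylinder omega n p) t)%:E).
Proof.
move=> mo n G p; have := measurable_cylinder mo n p => mc.
exact: (integrableZl measurableT (G p) (integrable_indic P mc)).
Qed.

Lemma integral_path_rv (R : realType) (d : nat) (disp : measure_display)
    (T : measurableType disp) (P : probability T R)
    (omega : nat -> T -> 'rV[int]_d.+1) :
  (forall n x, measurable (omega n @^-1` [set x])) ->
  forall n (G : 'rV[int]_d.+1 * seq 'rV[int]_d.+1 -> R),
  (\int[P]_t (path_rv omega n G t)%:E = (path_mean P omega n G)%:E)%E.
Proof.
move=> mo n G; rewrite /path_rv.
under eq_integral do rewrite -sumEFin.
rewrite integral_sum //; last exact: integrable_path_term.
rewrite /path_mean -sumEFin; apply: eq_bigr => p _.
have mc := measurable_cylinder mo n p.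
under eq_integral do rewrite EFinM.
rewrite integralZl //; last exact: integrable_indic.
by rewrite integral_indic // setIT mulrC EFinM fineK ?fin_num_measure.
Qed.

Lemma measurable_path_rv (R : realType) (d : nat) (disp : measure_display)
    (T : measurableType disp) (omega : nat -> T -> 'rV[int]_d.+1) :
  (forall n x, measurable (omega n @^-1` [set x])) ->
  forall n (G : 'rV[int]_d.+1 * seq 'rV[int]_d.+1 -> R),
  measurable_fun setT (path_rv omega n G).
Proof.
move=> mo n G; apply: measurable_sum => p.
apply: measurable_funM; first exact: measurable_cst.
exact/measurable_indic/measurable_cylinder.
Qed.

(** The indicator of the event is [path_rv] of the constant 1, whose mean is 1 because the step
    probabilities sum to 1. *)
Lemma ae_nn_path (R : realType) (d : nat) (beta : R) (disp : measure_display)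
    (T : measurableType disp) (P : probability T R)
    (omega : nat -> T -> 'rV[int]_d.+1) : is_ERW beta P omega ->
  {ae P, forall t, forall n, nn_path omega n t}.
Proof.
move=> erw; have [mo o0 _] := erw; apply/ae_foralln => n.
have E : path_rv omega n (fun=> 1 : R) = \1_[set t | nn_path omega n t].
  apply/funext => t; rewrite indicE.
  case: (boolP (t \in _)) => [|] /=.
    by rewrite inE => nnt; rewrite path_rv_nn.
  by rewrite notin_setE => nnt; rewrite path_rv_not_nn.
have mB : measurable [set t | nn_path omega n t].
  rewrite (_ : [set t | _] = path_rv omega n (fun=> 1 : R) @^-1` [set 1]).
    rewrite -[X in measurable X]setTI.
    exact: (measurable_path_rv mo n _ measurableT (measurable_set1 _)).
  rewrite E; apply/seteqP; split => t /=; rewrite indicE.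
    by move=> nn; rewrite mem_set.
  case: (boolP (t \in _)) => [|_ /eqP]; first by rewrite inE.
  by rewrite eq_sym oner_eq0.
have PB : P [set t | nn_path omega n t] = 1%E.
  rewrite -[X in P X]setIT -integral_indic // -E integral_path_rv //.
  by rewrite (path_mean_cst erw).
exists (~` [set t | nn_path omega n t]); split => //.
- exact: measurableC.
- by have := probability_setC P mB; rewrite PB subee.
Qed.

(** * From mean displacement to the drift *)

Lemma nn_path_coord_le (R : realType) (T : Type) (d : nat)
    (omega : nat -> T -> 'rV[int]_d.+1) (n : nat) (t : T) :
  omega 0%N t = 0 -> nn_path omega n t ->
  `|(omega n t ord0 ord0)%:~R| <= n%:R :> R.
Proof.
move=> o0; elim: n => [|n IH] nn; first by rewrite o0 mxE normr0.
have {}IH : `|(omega n t ord0 ord0)%:~R| <= n%:R :> R.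
  by apply: IH => k kn; apply: nn; apply: ltnW.
have -> : omega n.+1 t = omega n t + (omega n.+1 t - omega n t).
  by rewrite [omega n t + _]addrC subrK.
rewrite [X in X%:~R]mxE rmorphD /= -natr1; apply: le_trans (ler_normD _ _) _.
apply: lerD => //; have := nn n (ltnSn n).
move: (_ - _) => v; rewrite mem_cat => /orP[] /mapP[i _ ->]; rewrite !mxE /=;
  by case: (_ == _); rewrite ?normr0 ?oppr0 ?normr0 ?normrN1 ?normr1.
Qed.

(** The rescaled first coordinate converges almost surely and is bounded by 1, so dominated
    convergence carries the limit over to its mean, computed in [path_mean_coord]. *)
Lemma newcount_drift (R : realType) (d : nat) (beta : R)
    (theta : 'rV[R]_d.+1) : is_ERW_drift beta theta ->
  (fun n : nat => n%:R^-1 * (beta / d.+1%:R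
      * newcount beta n (0 : 'rV[int]_d.+1) [::])) @ \oo --> theta ord0 ord0.
Proof.
case=> disp [T [P [omega [erw cv]]]]; have [mo o0 _] := erw.
pose X (p : 'rV[int]_d.+1 * seq 'rV[int]_d.+1) : R := (p.1 ord0 ord0)%:~R.
pose f n t : \bar R := (n%:R^-1 * path_rv omega n X t)%:E.
have nn := ae_nn_path erw.
have := @dominated_convergence _ _ _ P setT measurableT f
  (cst (theta ord0 ord0)%:E) (cst 1%:E).
case.
- move=> n; apply/measurable_EFinP; apply: measurable_funM => //.
  exact: measurable_path_rv.
- exact: measurable_cst.
- apply: filterS2 nn cv => t nnt cvt _.
  have cvt' : (fun n : nat => (n%:R^-1 *: map_mx intr (omega n t)) ord0 ord0
      : R) @ \oo --> theta ord0 ord0.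
    exact: (cvg_comp _ _ cvt (@coord_continuous R _ _ ord0 ord0 theta)).
  apply/cvg_EFin; first by apply: nearW.
  rewrite (_ : fine \o _ = fun n : nat =>
    (n%:R^-1 *: map_mx intr (omega n t)) ord0 ord0) //.
  by apply/funext => n /=; rewrite !mxE path_rv_nn.
- exact: finite_measure_integrable_cst.
- apply: aeW => t n _; rewrite /f /= lee_fin normrM normfV normr_nat.
  have [nnt|nnt] := pselect (nn_path omega n t); last first.
    by rewrite path_rv_not_nn // normr0 mulr0.
  rewrite path_rv_nn //; case: n nnt => [|n] nnt; first by rewrite invr0 mul0r.
  rewrite mulrC ler_pdivrMr // mul1r.
  exact: nn_path_coord_le.
move=> _ _; rewrite integral_cst //.
rewrite [X in (_ * X)%E](@probability_setT _ _ _ P) mule1 => /fine_cvgP[_].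
apply: cvg_trans; apply: near_eq_cvg; apply: nearW => n /=.
rewrite /f; under eq_integral do rewrite EFinM.
rewrite integralZl //; last first.
  rewrite (_ : (fun t => _) = (fun t => \sum_(p <- paths d n)
      (X p * \1_(cylinder omega n p) t)%:E)%E); last first.
    by apply/funext => t; rewrite sumEFin.
  by apply: integrable_sum => // p _; exact: integrable_path_term.
by rewrite integral_path_rv // (path_mean_coord erw).
Qed.

Theorem theorem1p1 (R : realType) (d : nat) (hd : (9 <= d.+1)%N)
    (theta : R -> 'rV[R]_d.+1)
    (htheta : forall beta : R, 0 <= beta <= 1 -> is_ERW_drift beta (theta beta)) :
  forall beta1 beta2 : R, 0 <= beta1 -> beta1 < beta2 -> beta2 <= 1 ->
    theta beta1 ord0 ord0 < theta beta2 ord0 ord0.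
Proof.
move=> beta1 beta2 b1 b12 b2.
have hd8 : (8 <= d)%N by [].
have b1' : 0 <= beta1 <= 1 by rewrite b1 (le_trans (ltW b12)).
have b2' : 0 <= beta2 <= 1 by rewrite b2 (le_trans b1 (ltW b12)).
have cv1 := newcount_drift (htheta beta1 b1').
have cv2 := newcount_drift (htheta beta2 b2').
(* Strictness needs a gap that survives the limit: half of [beta2 - beta1] times [2 / 9], divided by
   the dimension. *)
have gap0 : 0 < (beta2 - beta1) / (9 * d.+1%:R).
  by rewrite divr_gt0 ?subr_gt0 // mulr_gt0.
rewrite -subr_gt0; apply: lt_le_trans gap0 _.
apply: (cvgr_to_ge (cvgB cv2 cv1)).
exists 1%N => // n /= n1.
have n0 : 0 < n%:R :> R by rewrite ltr0n.
have d0 : 0 < d.+1%:R :> R by [].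
have := newcount_growth hd8 b1 (ltW b12) b2 n (0 : 'rV[int]_d.+1) [::].
(* The walk starts with an empty past, so the potential vanishes. *)
rewrite /drift_potential big_nil subr0 => growth.
have -> : forall f g : nat -> R, (f - g) n = f n - g n by [].
set N2 := newcount beta2 _ _ _ in growth *.
set N1 := newcount beta1 _ _ _ in growth *.
have -> : n%:R^-1 * (beta2 / d.+1%:R * N2) - n%:R^-1 * (beta1 / d.+1%:R * N1)
    = (beta2 * N2 - beta1 * N1) / (n%:R * d.+1%:R).
  by field; rewrite nat1r !gt_eqF.
rewrite ler_pdivlMr ?mulr_gt0 //.
apply: le_trans growth; rewrite le_eqVlt; apply/orP; left; apply/eqP.
by field; rewrite nat1r pnatr_eq0.
Qed.
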